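(* Let $n\geq 1$ be an integer and $\mathbf{k}$ a field. The lattice of Dyck paths of length $n$ is isomorphic to the lattice of $\omega$-torsion pairs of the incidence algebra over $\mathbf{k}$ of the poset $(\operatorname{Int}([n-1]),\subseteq)^{op}$.
   Context: A Dyck path of length $n$ is a lattice path from $(0,0)$ to $(2n,0)$ with $2n$ steps, each equal to $(1,1)$ or $(1,-1)$, that never goes below the horizontal axis. Dyck paths of length $n$ are ordered by $D\leq D'$ if and only if $D$ lies weakly below $D'$ (i.e. at each abscissa the height of $D$ is at most the height of $D'$); this is the lattice of Dyck paths. $[m]$ denotes a totally ordered set with $m$ elements, say $1<2<\dots<m$, and $(\operatorname{Int}([m]),\subseteq)$ is the poset of (nonempty) intervals $[i,j]=\{i,i+1,\dots,j\}$, $1\leq i\leq j\leq m$, ordered by containment. $(-)^{op}$ denotes the poset with reversed order. The incidence algebra of a finite poset $(P,\leq)$ over $\mathbf{k}$ is the finite dimensional $\mathbf{k}$-algebra with basis $\{e_{x,y} : x\leq y \text{ in } P\}$ and multiplication $e_{x,y}e_{y',z}=e_{x,z}$ if $y=y'$ and $0$ otherwise. For a finite dimensional algebra $A$, $\operatorname{mod} A$ denotes the category of finitely generated right $A$-modules. Subcategories are full and closed under isomorphisms. A torsion pair of $\operatorname{mod} A$ is a pair $(\mathcal{T},\mathcal{F})$ of subcategories such that (1) $\operatorname{Hom}_A(T,F)=0$ for all $T\in\mathcal{T}$, $F\in\mathcal{F}$; (2) for every $X\in\operatorname{mod} A$ there is a short exact sequence $0\to t(X)\to X\to f(X)\to 0$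 with $t(X)\in\mathcal{T}$ and $f(X)\in\mathcal{F}$. An $\omega$-torsion pair (also called $\omega_1$-torsion pair) of $A$ is a torsion pair $(\mathcal{T},\mathcal{F})$ of $\operatorname{mod} A$ such that $\operatorname{Ext}^1_A(T,F)=0$ for all $T\in\mathcal{T}$, $F\in\mathcal{F}$. The $\omega$-torsion pairs are ordered by $(\mathcal{T}_1,\mathcal{F}_1)\leq(\mathcal{T}_2,\mathcal{F}_2)$ if and only if $\mathcal{T}_1\subseteq\mathcal{T}_2$ (equivalently $\mathcal{F}_2\subseteq\mathcal{F}_1$). *)

(* Defs.v *)
From HB Require Import structures.
From mathcomp Require Import all_boot all_order all_algebra.
From mathcomp Require Import zify.

Set Implicit Arguments.
Unset Strict Implicit.
Unset Printing Implicit Defensive.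

Import Order.TTheory GRing.Theory Num.Theory.
Local Open Scope ring_scope.

(* A path is the word of its steps: [true] is (1,1) and [false] is (1,-1).
   [height s i] is the ordinate of the path at abscissa [i]. *)
Definition height (s : seq bool) (i : nat) : int :=
  \sum_(b <- take i s) (if b then 1 else -1).

Definition is_dyck (n : nat) (t : n.*2.-tuple bool) : bool :=
  [forall i : 'I_n.*2.+1, 0 <= height t i] && (height t n.*2 == 0).

Record dyck (n : nat) : Type := Dyck {
  dyck_steps :> n.*2.-tuple bool;
  dyckP : is_dyck dyck_steps }.

HB.instance Definition _ n := [isSub of dyck n for @dyck_steps n].
HB.instance Definition _ n := [Finite of dyck n by <:].

Section DyckLattice.
Variable n : nat.
Implicit Types D E : dyck n.

(* Paths are affine between consecutive integers, so the integral abscissae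
   decide whether a path is weakly below another one. *)
Definition dyck_le D E : bool :=
  [forall i : 'I_n.*2.+1, height D i <= height E i].

Lemma height0 s : height s 0 = 0.
Proof. by rewrite /height take0 big_nil. Qed.

Lemma heightS s i : (i < size s)%N ->
  height s i.+1 = height s i + (if nth false s i then 1 else -1).
Proof. by move=> lt_i; rewrite /height (take_nth false) // -cats1 big_cat big_seq1. Qed.

Lemma dyck_heightS D i : (i < n.*2)%N ->
  height D i.+1 = height D i + (if nth false D i then 1 else -1).
Proof. by move=> lt_i; rewrite heightS // size_tuple. Qed.

Lemma dyck_leP D E :
  reflect (forall i, (i <= n.*2)%N -> height D i <= height E i) (dyck_le D E).
Proof.
apply: (iffP forallP) => [le_DE i le_i | le_DE i]; last exact/le_DE/leq_ord.
by rewrite -ltnS in le_i; apply: (le_DE (Ordinal le_i)).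
Qed.

Lemma dyck_height_ge0 D i : (i <= n.*2)%N -> 0 <= height D i.
Proof.
case: D => t /= /andP[/forallP t_ge0 _]; rewrite -ltnS => le_i.
exact: (t_ge0 (Ordinal le_i)).
Qed.

Lemma dyck_height_end D : height D n.*2 = 0.
Proof. by case: D => t /= /andP[_ /eqP]. Qed.

Lemma dyck_le_refl : reflexive dyck_le.
Proof. by move=> D; apply/dyck_leP. Qed.

Lemma dyck_le_anti : antisymmetric dyck_le.
Proof.
move=> D E /andP[/dyck_leP le_DE /dyck_leP le_ED].
have eqh i : (i <= n.*2)%N -> height D i = height E i.
  by move=> le_i; apply/le_anti; rewrite le_DE ?le_ED.
apply/val_inj/val_inj; apply: (@eq_from_nth _ false); rewrite ?size_tuple // => i lt_i.
have := eqh _ lt_i; rewrite !dyck_heightS // eqh 1?ltnW //.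
by case: nth; case: nth => //; lia.
Qed.

Lemma dyck_le_trans : transitive dyck_le.
Proof.
move=> E D F /dyck_leP le_DE /dyck_leP le_EF; apply/dyck_leP => i le_i.
exact: le_trans (le_DE _ le_i) (le_EF _ le_i).
Qed.

HB.instance Definition _ := Order.Le_isPOrder.Build (Order.Disp tt tt) (dyck n)
  dyck_le_refl dyck_le_anti dyck_le_trans.

Definition steps_of (f : nat -> int) : n.*2.-tuple bool :=
  [tuple f i < f i.+1 | i < n.*2].

Lemma height_steps_of (f : nat -> int) :
    f 0 = 0 ->
    (forall i, (i < n.*2)%N -> f i.+1 = f i + 1 \/ f i.+1 = f i - 1) ->
  forall i, (i <= n.*2)%N -> height (steps_of f) i = f i.
Proof.
move=> f0 fS; elim=> [|i IHi] lt_i; first by rewrite height0.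
rewrite heightS ?size_tuple // IHi 1?ltnW //.
rewrite -[i in nth _ _ i]/(val (Ordinal lt_i)) -tnth_nth tnth_mktuple /=.
by case: (fS i lt_i) => ->; case: ifP; lia.
Qed.

Lemma height_parity D E i : (i <= n.*2)%N ->
  exists z : int, height D i = height E i + z *+ 2.
Proof.
elim: i => [|i IHi] lt_i; first by exists 0; rewrite !height0.
have [z eq_z] := IHi (ltnW lt_i); rewrite !dyck_heightS // eq_z.
by case: nth; case: nth; [exists z | exists (z + 1) | exists (z - 1) | exists z]; lia.
Qed.

Definition meet_height D E i := Num.min (height D i) (height E i).
Definition join_height D E i := Num.max (height D i) (height E i).

Lemma height_meet D E i : (i <= n.*2)%N ->
  height (steps_of (meet_height D E)) i = meet_height D E i.
Proof.
apply: height_steps_of => [|{}i lt_i]; first by rewrite /meet_height !height0 minxx.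
rewrite /meet_height !dyck_heightS //.
have [z eq_z] := height_parity D E (ltnW lt_i); rewrite eq_z.
by case: nth; case: nth; rewrite !minEle; do 2![case: ifP]; lia.
Qed.

Lemma height_join D E i : (i <= n.*2)%N ->
  height (steps_of (join_height D E)) i = join_height D E i.
Proof.
apply: height_steps_of => [|{}i lt_i]; first by rewrite /join_height !height0 maxxx.
rewrite /join_height !dyck_heightS //.
have [z eq_z] := height_parity D E (ltnW lt_i); rewrite eq_z.
by case: nth; case: nth; rewrite !maxEle; do 2![case: ifP]; lia.
Qed.

Lemma is_dyck_meet D E : is_dyck (steps_of (meet_height D E)).
Proof.
apply/andP; split; last by rewrite height_meet // /meet_height !dyck_height_end.
apply/forallP => i; have le_i := leq_ord i.
by rewrite height_meet // /meet_height le_min !dyck_height_ge0.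
Qed.

Lemma is_dyck_join D E : is_dyck (steps_of (join_height D E)).
Proof.
apply/andP; split; last by rewrite height_join // /join_height !dyck_height_end.
apply/forallP => i; have le_i := leq_ord i.
by rewrite height_join // /join_height le_max !dyck_height_ge0.
Qed.

Definition dyck_meet D E : dyck n := Dyck (is_dyck_meet D E).
Definition dyck_join D E : dyck n := Dyck (is_dyck_join D E).

Lemma dyck_lexI D E F : (D <= dyck_meet E F)%O = (D <= E)%O && (D <= F)%O.
Proof.
apply/dyck_leP/andP => [le_D | [/dyck_leP leE /dyck_leP leF] i le_i].
  by split; apply/dyck_leP => i le_i; have := le_D i le_i;
     rewrite /= height_meet // /meet_height le_min => /andP[].
by rewrite /= height_meet // /meet_height le_min leE ?leF.
Qed.

Lemma dyck_leUx D E F : (dyck_join D E <= F)%O = (D <= F)%O && (E <= F)%O.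
Proof.
apply/dyck_leP/andP => [le_F | [/dyck_leP leD /dyck_leP leE] i le_i].
  by split; apply/dyck_leP => i le_i; have := le_F i le_i;
     rewrite /= height_join // /join_height ge_max => /andP[].
by rewrite /= height_join // /join_height ge_max leD ?leE.
Qed.

HB.instance Definition _ :=
  Order.POrder_MeetJoin_isLattice.Build (Order.Disp tt tt) (dyck n)
    dyck_lexI dyck_leUx.

End DyckLattice.

(* The totally ordered set with [m] elements is ['I_m] = {0 < ... < m-1}. *)
Record Int (m : nat) : Type := MkInt {
  Int_ends : 'I_m * 'I_m;
  IntP : (Int_ends.1 <= Int_ends.2)%N }.

HB.instance Definition _ m := [isSub of Int m for @Int_ends m].
HB.instance Definition _ m := [Finite of Int m by <:].

Section IntOrder.
Variable m : nat.
Implicit Types I J : Int m.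

Definition Int_set I : {set 'I_m} :=
  [set x : 'I_m | ((Int_ends I).1 <= x <= (Int_ends I).2)%N].

Definition Int_le I J : bool := Int_set I \subset Int_set J.

Lemma Int_leE I J :
  Int_le I J = ((Int_ends J).1 <= (Int_ends I).1)%N
               && ((Int_ends I).2 <= (Int_ends J).2)%N.
Proof.
apply/subsetP/andP => [sIJ | [le1 le2] x]; last by rewrite !inE; lia.
have := sIJ (Int_ends I).1; have := sIJ (Int_ends I).2.
by rewrite !inE !leqnn !IntP => /(_ isT)/andP[_ ->] /(_ isT)/andP[].
Qed.

Lemma Int_le_refl : reflexive Int_le.
Proof. by move=> I; apply: subxx. Qed.

Lemma Int_le_anti : antisymmetric Int_le.
Proof.
move=> I J; rewrite !Int_leE => le_IJ; apply/val_inj => /=.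
by apply/eqP; rewrite -pair_eqE /= -!val_eqE /=; lia.
Qed.

Lemma Int_le_trans : transitive Int_le.
Proof. by move=> J I K; apply: subset_trans. Qed.

HB.instance Definition _ := Order.Le_isPOrder.Build (Order.Disp tt tt) (Int m)
  Int_le_refl Int_le_anti Int_le_trans.

End IntOrder.

Definition incidence_algebra (k : fieldType) (d : Order.disp_t)
    (P : finPOrderType d) : Type :=
  {ffun {xy : P * P | (xy.1 <= xy.2)%O} -> k}.

Section IncidenceAlgebra.
Variables (k : fieldType) (d : Order.disp_t) (P : finPOrderType d).
Local Notation A := (incidence_algebra k P).

HB.instance Definition _ := GRing.Lmodule.copy A
  {ffun {xy : P * P | (xy.1 <= xy.2)%O} -> k^o}.

Implicit Types f g h : A.

(* The coefficient of [f] on the basis element e_{x,y}; it is 0 when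
   [x <= y] does not hold. *)
Definition ia_coef f (x y : P) : k :=
  if insub (x, y) is Some u then f u else 0.

Definition ia_e (x y : P) : A := [ffun u => (val u == (x, y))%:R].

Definition ia_one : A := [ffun u => ((val u).1 == (val u).2)%:R].

(* The bilinear extension of e_{x,y} e_{y',z} = e_{x,z} if y = y', else 0;
   see [ia_eM] below. *)
Definition ia_mul f g : A :=
  [ffun u => \sum_(y : P) ia_coef f (val u).1 y * ia_coef g y (val u).2].

Lemma ia_coef_out f x y : ~~ (x <= y)%O -> ia_coef f x y = 0.
Proof. by move=> nle; rewrite /ia_coef insubN. Qed.

Lemma ia_coefP f g : (forall x y, (x <= y)%O -> ia_coef f x y = ia_coef g x y) -> f = g.
Proof.
move=> eq_fg; apply/ffunP => -[[x y] le_xy].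
by have := eq_fg x y le_xy; rewrite /ia_coef insubT.
Qed.

Lemma ia_coef_one x y : ia_coef ia_one x y = (x == y)%:R.
Proof.
rewrite /ia_coef; case: insubP => [u _ eq_u | /=]; first by rewrite ffunE eq_u.
by case: eqP => [-> | //]; rewrite lexx.
Qed.

Lemma ia_coef_e x y x' y' : (x <= y)%O ->
  ia_coef (ia_e x y) x' y' = ((x' == x) && (y' == y))%:R.
Proof.
move=> le_xy; rewrite /ia_coef; case: insubP => [u _ eq_u | /=].
  by rewrite ffunE eq_u xpair_eqE.
by case: eqP => [-> | //]; case: eqP => [-> | //]; rewrite le_xy.
Qed.

Lemma ia_coefD f g x y : ia_coef (f + g) x y = ia_coef f x y + ia_coef g x y.
Proof. by rewrite /ia_coef; case: insubP => [u _ _ | _]; rewrite ?ffunE ?addr0. Qed.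

Lemma ia_coefZ c f x y : ia_coef (c *: f) x y = c * ia_coef f x y.
Proof. by rewrite /ia_coef; case: insubP => [u _ _ | _]; rewrite ?ffunE ?mulr0. Qed.

Lemma ia_coefM f g x z :
  ia_coef (ia_mul f g) x z = \sum_(y : P) ia_coef f x y * ia_coef g y z.
Proof.
rewrite {1}/ia_coef; case: insubP => [u _ eq_u | /= nle]; first by rewrite ffunE eq_u.
rewrite big1 // => y _; have [le_xy | /ia_coef_out->] := boolP (x <= y)%O; last first.
  by rewrite mul0r.
by rewrite [ia_coef g _ _]ia_coef_out ?mulr0 //; apply: contra nle; apply: le_trans.
Qed.

Lemma ia_mulA : associative ia_mul.
Proof.
move=> f g h; apply: ia_coefP => x t _; rewrite !ia_coefM.
under eq_bigr do rewrite ia_coefM mulr_sumr.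
rewrite exchange_big; apply: eq_bigr => z _ /=.
by rewrite ia_coefM mulr_suml; apply: eq_bigr => y _; rewrite mulrA.
Qed.

Lemma ia_mul1 : left_id ia_one ia_mul.
Proof.
move=> f; apply: ia_coefP => x z _; rewrite ia_coefM (bigD1 x) //=.
rewrite ia_coef_one eqxx mul1r big1 ?addr0 // => y ne_yx.
by rewrite ia_coef_one eq_sym (negPf ne_yx) mul0r.
Qed.

Lemma ia_mulr1 : right_id ia_one ia_mul.
Proof.
move=> f; apply: ia_coefP => x z _; rewrite ia_coefM (bigD1 z) //=.
rewrite ia_coef_one eqxx mulr1 big1 ?addr0 // => y ne_yz.
by rewrite ia_coef_one (negPf ne_yz) mulr0.
Qed.

Lemma ia_mulDl : left_distributive ia_mul +%R.
Proof.
move=> f g h; apply: ia_coefP => x z _; rewrite ia_coefD !ia_coefM -big_split.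
by apply: eq_bigr => y _; rewrite ia_coefD mulrDl.
Qed.

Lemma ia_mulDr : right_distributive ia_mul +%R.
Proof.
move=> f g h; apply: ia_coefP => x z _; rewrite ia_coefD !ia_coefM -big_split.
by apply: eq_bigr => y _; rewrite ia_coefD mulrDr.
Qed.

(* This is the zero ring when [P] is empty, hence [pzRingType]; the algebra
   structures of the library exclude the zero ring, so the compatibility of
   the product with the scalars is stated separately. *)
HB.instance Definition _ := GRing.Zmodule_isPzRing.Build A
  ia_mulA ia_mul1 ia_mulr1 ia_mulDl ia_mulDr.

Lemma ia_scaleAl (c : k) f g : c *: (f * g) = (c *: f) * g.
Proof.
apply: ia_coefP => x z _; rewrite ia_coefZ !ia_coefM mulr_sumr.
by apply: eq_bigr => y _; rewrite ia_coefZ mulrA.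
Qed.

Lemma ia_scaleAr (c : k) f g : c *: (f * g) = f * (c *: g).
Proof.
apply: ia_coefP => x z _; rewrite ia_coefZ !ia_coefM mulr_sumr.
by apply: eq_bigr => y _; rewrite ia_coefZ mulrCA.
Qed.

Lemma ia_eM x y y' z : (x <= y)%O -> (y' <= z)%O ->
  ia_e x y * ia_e y' z = if y == y' then ia_e x z else 0.
Proof.
move=> le_xy le_yz; apply: ia_coefP => s t le_st; rewrite ia_coefM (bigD1 y) //=.
rewrite big1 ?addr0 => [|u /negPf ne_uy]; last first.
  by rewrite ia_coef_e // ne_uy andbF mul0r.
rewrite !ia_coef_e // eqxx andbT -natrM mulnb.
have [eq_y | ne_y] := eqVneq y y'; first by rewrite ia_coef_e // (le_trans le_xy) ?eq_y.
by rewrite andbF /ia_coef; case: insub => // u; rewrite ffunE.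
Qed.

Lemma ia_sum_e f : f = \sum_u f u *: ia_e (val u).1 (val u).2.
Proof.
apply/ffunP => v; rewrite sum_ffunE (bigD1 v) //= big1 => [|u ne_uv].
  by rewrite !ffunE -surjective_pairing eqxx addr0 [_ *: _]mulr1.
by rewrite !ffunE -surjective_pairing val_eqE eq_sym (negPf ne_uv) scaler0.
Qed.

End IncidenceAlgebra.

(* Right [A]-modules are the left modules over the converse ring [A^c]. *)
Section TorsionPairs.
Variable A : pzRingType.

Definition finitely_generated (M : lmodType A^c) : Prop :=
  exists s : seq M, forall x : M,
    exists c : 'I_(size s) -> A^c, x = \sum_(i < size s) c i *: s`_i.

Record fgmod : Type := FGMod {
  fgmod_sort :> lmodType A^c;
  fgmodP : finitely_generated fgmod_sort }.

Definition isomorphic (M N : fgmod) : Prop :=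
  exists f : {linear M -> N}, bijective f.

Definition short_exact (L M N : lmodType A^c)
    (i : {linear L -> M}) (p : {linear M -> N}) : Prop :=
  [/\ injective i,
      forall z : N, exists y : M, p y = z
    & forall y : M, p y = 0 <-> exists x : L, i x = y].

Definition Hom_zero (M N : fgmod) : Prop :=
  forall (f : {linear M -> N}) (x : M), f x = 0.

(* Ext^1(M,N) is taken in the sense of Yoneda: equivalence classes of short
   exact sequences 0 -> N -> E -> M -> 0, the zero class being that of the
   direct sum. *)
Record extension (M N : fgmod) : Type := Extension {
  ext_mid :> fgmod;
  ext_inj : {linear N -> ext_mid};
  ext_prj : {linear ext_mid -> M};
  extP : short_exact ext_inj ext_prj }.

(* Such an [f] is an isomorphism, by the five lemma. *)
Definition ext_equiv (M N : fgmod) (E E' : extension M N) : Prop :=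
  exists f : {linear E -> E'},
    (forall y : N, f (ext_inj E y) = ext_inj E' y)
    /\ (forall x : E, ext_prj E' (f x) = ext_prj E x).

Section SplitExtension.
Variables M N : fgmod.

Lemma finitely_generated_pair : finitely_generated (N * M)%type.
Proof.
have [sN genN] := fgmodP N; have [sM genM] := fgmodP M.
exists ([seq (y, 0) | y <- sN] ++ [seq (0, x) | x <- sM]) => -[y x].
have [cN ->] := genN y; have [cM ->] := genM x.
set s := _ ++ _.
pose c (i : nat) : A^c := if insub i is Some j then cN j
  else if insub (i - size sN)%N is Some j then cM j else 0.
exists (fun i => c i).
rewrite -(big_mkord xpredT (fun i => c i *: s`_i)) /s size_cat !size_map.
rewrite (@big_cat_nat _ _ _ (size sN)) ?leq_addr //=.
have shiftE (F : nat -> (N * M)%type) a b :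
    \sum_(a <= i < a + b) F i = \sum_(i < b) F (i + a)%N.
  by rewrite -{1}[a]add0n big_addn addKn big_mkord.
rewrite (shiftE _ (size sN)) big_mkord.
rewrite (eq_bigr (fun j => (cN j *: sN`_j, 0))) => [|j _]; last first.
  rewrite /c insubT // => lt_j; rewrite nth_cat size_map lt_j (nth_map 0) //.
  by congr (_, _); [congr (cN _ *: _); apply/val_inj | rewrite scaler0].
rewrite [X in _ + X](eq_bigr (fun j => (0, cM j *: sM`_j))) => [|j _]; last first.
  rewrite /c insubN -?leqNgt ?leq_addl // addnK insubT // => lt_j.
  rewrite nth_cat size_map ltnNge leq_addl /= addnK (nth_map 0) //.
  by congr (_, _); [rewrite scaler0 | congr (cM _ *: _); apply/val_inj].
rewrite [RHS]surjective_pairing; congr (_, _).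
  by rewrite raddfD /= !raddf_sum /= [X in _ + X]big1 ?addr0.
by rewrite raddfD /= !raddf_sum /= [X in X + _]big1 ?add0r.
Qed.

Definition dsum : fgmod := FGMod finitely_generated_pair.

Definition dsum_in (y : N) : dsum := (y, 0).
Definition dsum_out (z : dsum) : M := z.2.

Lemma dsum_in_linear : linear dsum_in.
Proof. by move=> a y y'; apply: injective_projections => //=; rewrite scaler0 addr0. Qed.

Lemma dsum_out_linear : linear dsum_out.
Proof. by []. Qed.

HB.instance Definition _ :=
  GRing.isLinear.Build A^c N dsum *:%R dsum_in dsum_in_linear.
HB.instance Definition _ :=
  GRing.isLinear.Build A^c dsum M *:%R dsum_out dsum_out_linear.

Lemma dsum_exact : short_exact dsum_in dsum_out.
Proof.
split=> [y y' [] // | x | [y x]]; first by exists (0, x).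
by split=> [/= -> | [y' [_ <-]] //]; exists y.
Qed.

Definition split_extension : extension M N := Extension dsum_exact.

End SplitExtension.

Definition Ext1_zero (M N : fgmod) : Prop :=
  forall E : extension M N, ext_equiv E (split_extension M N).

(* A full subcategory closed under isomorphisms, given by its objects. *)
Record subcategory : Type := Subcategory {
  in_subcat :> fgmod -> Prop;
  subcat_iso : forall M N, isomorphic M N -> in_subcat M -> in_subcat N }.

Definition torsion_pair (T F : subcategory) : Prop :=
  (forall X Y : fgmod, T X -> F Y -> Hom_zero X Y)
  /\ (forall X : fgmod,
        exists (tX fX : fgmod) (i : {linear tX -> X}) (p : {linear X -> fX}),
          [/\ T tX, F fX & short_exact i p]).

Record omega_torsion_pair : Type := OmegaTorsionPair {
  tors : subcategory;
  tfree : subcategory;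
  otp_torsion_pair : torsion_pair tors tfree;
  otp_Ext1 : forall X Y : fgmod, tors X -> tfree Y -> Ext1_zero X Y }.

Definition otp_le (p q : omega_torsion_pair) : Prop :=
  forall X : fgmod, tors p X -> tors q X.

End TorsionPairs.

(* Main.v *)
Require Import Defs.
From HB Require Import structures.
From mathcomp Require Import all_boot all_order all_algebra.
From mathcomp Require Import zify ring boolp.

Set Implicit Arguments.
Unset Strict Implicit.
Unset Printing Implicit Defensive.

Import Order.TTheory GRing.Theory Num.Theory.
Local Open Scope ring_scope.

(** The [omega]-torsion pairs of the incidence algebra of a finite poset [P] are
in bijection with the up-sets of [P], and for [P] the opposite of the poset of
intervals the up-sets are drawn as Dyck paths.

A right module [M] is a family of spaces [M e_x] with maps [M e_x -> M e_y] for
[x <= y]. If [S] is an up-set, the elements supported on [S] form a submodule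
of [M], and the quotient is supported off [S]; so the modules supported on [S]
and those supported off [S] form a torsion pair ([vanishing_torsion_pair]).
In an extension of the former by the latter, the part supported on [S] is a
submodule which maps isomorphically onto the quotient, so the extension splits
([vanishing_Ext1]).

Conversely let [(T, F)] be an [omega]-torsion pair. Each simple module
[simple_mod k x] lies in [T] or in [F]; let [S] be the set of the [x] for which
it lies in [T]. If [y] covers [x], there is a non-split extension of the simple
module at [x] by the one at [y] ([cover_Ext1_neq0]), so [x \in S] forces
[y \in S], and [S] is an up-set. A nonzero morphism from a module supported on
[S] to an object of [F] would, at a maximal vertex where it is nonzero, give a
nonzero morphism from a simple object of [T] to that object; hence the modules
supported on [S] are in [T] ([supported_tors]). Dually the modules supported
off [S] are in [F] ([vanishing_tfree]). These two inclusions between torsion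
pairs are equalities, since each class of a torsion pair is the orthogonal of
the other one ([up_set_otp_surj]).

On the combinatorial side, the interval [[i, j]] is the point of abscissa
[i + j + 2] and ordinate [j - i + 2], with indices starting from 0. The
intervals whose point is weakly below a path [D] form a down-set of intervals,
[D <= E] means inclusion of these down-sets ([dyck_le_under]), and every
down-set is obtained as a join of paths with a single high peak
([dyck_under_ideal]). *)

(** * A linear functional that does not vanish at a given vector *)

(** A minimal spanning subfamily is a basis, and some coordinate of [w] in this
basis is nonzero. *)
Lemma exists_functional (k : fieldType) (V : lmodType k) (I : finType)
    (t : I -> V) (w : V) :
    (forall v, exists c : I -> k, v = \sum_i c i *: t i) -> w != 0 ->
  exists2 l : V -> k,
    (forall a u v, l (a *: u + v) = a * l u + l v) & l w != 0.
Proof.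
move=> span_t nz_w.
pose spans (B : {set I}) := `[< forall v, exists c : I -> k,
  v = \sum_(i in B) c i *: t i >].
have spansT : spans setT.
  apply/asboolP => v; have [c ->] := span_t v; exists c.
  by apply: eq_bigl => i; rewrite inE.
have [B /minsetP[/asboolP spanB minB] _] := minset_exists spansT.
(* A relation with [c i <> 0] expresses [t i] by the rest of the family, which
   contradicts minimality. *)
have freeB (c : I -> k) : \sum_(i in B) c i *: t i = 0 -> {in B, forall i, c i = 0}.
  move=> c0 i Bi; apply/eqP/contraT => nz_ci.
  have : B :\ i = B.
    apply: minB (subsetDl _ _); apply/asboolP => v; have [b ->] := spanB v.
    exists (fun j => b j - b i / c i * c j).
    rewrite (bigD1 i) //= (eq_bigl (mem (B :\ i))) => [|j]; last first.
      by rewrite !inE andbC.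
    under [RHS]eq_bigr do rewrite scalerBl -scalerA.
    rewrite sumrB -scaler_sumr.
    move: c0; rewrite (bigD1 i) //= (eq_bigl (mem (B :\ i))) => [/eqP|j].
      rewrite addrC addr_eq0 => /eqP ->.
      by rewrite scalerN scalerA divfK // opprK addrC.
    by rewrite !inE andbC.
  by move/setP/(_ i); rewrite !inE eqxx Bi.
have exB v : exists c : {ffun I -> k}, v == \sum_(i in B) c i *: t i.
  have [c ->] := spanB v; exists [ffun i => c i].
  by apply/eqP/eq_bigr => i _; rewrite ffunE.
pose crd v := xchoose (exB v).
have crdP v : v = \sum_(i in B) crd v i *: t i := eqP (xchooseP (exB v)).
have [i Bi nz_i] : exists2 i, i \in B & crd w i != 0.
  apply/exists_inP/contraT; rewrite negb_exists_in => /forall_inP crd0.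
  case/eqP: nz_w; rewrite (crdP w) big1 // => i Bi.
  by have /negPn/eqP-> := crd0 i Bi; rewrite scale0r.
exists (crd^~ i) => // a u v; apply/eqP; rewrite -subr_eq0; apply/eqP.
apply: (freeB (fun i => crd (a *: u + v) i - (a * crd u i + crd v i))) Bi.
under eq_bigr do rewrite scalerBl scalerDl -scalerA.
by rewrite sumrB big_split /= -scaler_sumr -!crdP subrr.
Qed.

(** * Vertex idempotents and up-sets *)

Section Alg.
Variables (k : fieldType) (d : Order.disp_t) (P : finPOrderType d).
Local Notation A := (incidence_algebra k P).
Implicit Types (a b : A) (x y z : P) (S : {set P}) (c : k).

(** The sum of the [e_{x,x}] for [x \in S]; acting on the right, it projects a
module onto its part supported on [S]. *)
Definition idem S : A := [ffun u => (((val u).1 \in S) && ((val u).1 == (val u).2))%:R].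

Lemma coef_idem S x y : ia_coef (idem S) x y = ((x \in S) && (x == y))%:R.
Proof.
rewrite /ia_coef; case: insubP => [u _ eq_u | /=]; first by rewrite ffunE eq_u.
by case: eqP => [-> | //]; rewrite ?lexx ?andbF.
Qed.

Lemma coef_idemM S a x y : ia_coef (idem S * a) x y = (x \in S)%:R * ia_coef a x y.
Proof.
rewrite ia_coefM (bigD1 x) //= big1 => [|z /negPf ne_zx].
  by rewrite addr0 coef_idem eqxx andbT.
by rewrite coef_idem eq_sym ne_zx andbF mul0r.
Qed.

Lemma coef_Midem S a x y : ia_coef (a * idem S) x y = ia_coef a x y * (y \in S)%:R.
Proof.
rewrite ia_coefM (bigD1 y) //= big1 => [|z /negPf ne_zy].
  by rewrite addr0 coef_idem eqxx andbT.
by rewrite coef_idem ne_zy andbF mulr0.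
Qed.

Definition coefE := (coef_idemM, coef_Midem, coef_idem, ia_coefD, ia_coefZ).

Lemma idemI S1 S2 : idem S1 * idem S2 = idem (S1 :&: S2).
Proof. by apply: ia_coefP => x y _; rewrite !coefE inE -natrM mulnb andbA. Qed.

Lemma idemT : idem setT = 1.
Proof. by apply: ia_coefP => x y _; rewrite coef_idem ia_coef_one inE. Qed.

Lemma idem0 : idem set0 = 0.
Proof. by apply/ffunP => u; rewrite !ffunE inE. Qed.

Lemma idemC S : idem S + idem (~: S) = 1.
Proof.
apply: ia_coefP => x y _; rewrite !coefE ia_coef_one inE -natrD.
by case: (x \in S); case: (x == y).
Qed.

Lemma idem_sum S : idem S = \sum_(x in S) idem [set x].
Proof.
apply/ffunP => -[[x y] le_xy]; rewrite sum_ffunE !ffunE /=.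
under eq_bigr do rewrite ffunE /= inE.
have [Sx | /negPf nSx] := boolP (x \in S); last first.
  by rewrite big1 // => z Sz; case: eqP => // eq_xz; rewrite eq_xz Sz in nSx.
by rewrite (bigD1 x) //= eqxx big1 ?addr0 // => z /andP[_ /negPf]; rewrite eq_sym => ->.
Qed.

Definition up_set S := forall x y, (x <= y)%O -> x \in S -> y \in S.

(** A coefficient [a_{x,y}] with [x \in S] is nonzero only for [y \in S]; hence
the part of a right module supported on [S] is a submodule. *)
Lemma up_set_idem S a : up_set S -> idem S * a * idem S = idem S * a.
Proof.
move=> upS; apply: ia_coefP => x y le_xy; rewrite !coefE.
by case: (boolP (x \in S)) => [/(upS _ _ le_xy)->|]; rewrite ?mulr1 ?mul0r.
Qed.

Lemma up_set_idemC S a : up_set S -> idem (~: S) * a * idem (~: S) = a * idem (~: S).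
Proof.
move=> upS; apply: ia_coefP => x y le_xy; rewrite !coefE !inE.
have [Sx | /=] := boolP (x \in S); last by rewrite mul1r.
by rewrite (upS _ _ le_xy Sx) !mulr0.
Qed.

(** Modulo the vertices strictly above [x], the element [a] acts on the space at
[x] by the scalar [a_{x,x}]. *)
Lemma idem1M x a : idem [set x] * a =
  ia_coef a x x *: idem [set x] + idem [set x] * a * idem [set y | (x < y)%O].
Proof.
apply: ia_coefP => y z le_yz; rewrite !coefE !inE.
have [eq_yx | _] := eqVneq y x; last by rewrite !mul0r mulr0 addr0.
rewrite eq_yx in le_yz *; rewrite /= lt_neqAle le_yz andbT !mul1r.
by have [<- | _] := eqVneq x z; rewrite ?mulr1 ?mulr0 ?addr0 ?add0r.
Qed.

(** The same decomposition on the other side: what [a] brings to the vertex [x]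
from elsewhere comes from the vertices strictly below [x]. *)
Lemma Midem1 x a : a * idem [set x] =
  ia_coef a x x *: idem [set x] + idem [set y | (y < x)%O] * a * idem [set x].
Proof.
apply: ia_coefP => y z le_yz; rewrite !coefE !inE.
have [eq_zx | ne_zx] := eqVneq z x; last first.
  rewrite !mulr0 addr0; have [-> | _] := eqVneq y x; last by rewrite mulr0.
  by rewrite eq_sym (negPf ne_zx) mulr0.
rewrite eq_zx in le_yz *; rewrite /= lt_neqAle le_yz andbT !mulr1 andbb.
by have [-> | _] := eqVneq y x; rewrite ?mulr1 ?mulr0 ?mul0r ?mul1r ?addr0 ?add0r.
Qed.

(** * Modules as vector spaces *)

Implicit Types M N : lmodType A^c.

(** Modules are over the converse ring, so the factors are swapped when actions
are composed. *)
Lemma actM M a b (v : M) : (a : A^c) *: ((b : A^c) *: v) = ((b * a : A) : A^c) *: v.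
Proof. by rewrite scalerA. Qed.

Definition scal c : A^c := c *: (1 : A).

Lemma scalE M c a (v : M) : (c *: a : A^c) *: v = scal c *: ((a : A^c) *: v).
Proof. by rewrite actM -ia_scaleAr mulr1. Qed.

Lemma scalC M c a (v : M) : scal c *: ((a : A^c) *: v) = (a : A^c) *: (scal c *: v).
Proof. by rewrite !actM -ia_scaleAr -ia_scaleAl mulr1 mul1r. Qed.

(** A copy of [M] that carries the structure of [k]-vector space. *)
Definition over_k M : Type := M.
HB.instance Definition _ M := GRing.Zmodule.on (over_k M).

Section OverK.
Variable M : lmodType A^c.
Definition k_scale c (v : over_k M) : over_k M := scal c *: (v : M).

Lemma k_scaleA c c' v : k_scale c (k_scale c' v) = k_scale (c * c') v.
Proof.
by rewrite /k_scale actM /scal -ia_scaleAl mul1r scalerA mulrC.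
Qed.
Lemma k_scale1 : left_id 1 k_scale.
Proof. by move=> v; rewrite /k_scale /scal scale1r [LHS]scale1r. Qed.
Lemma k_scaleDr : right_distributive k_scale +%R.
Proof. by move=> c u v; apply: scalerDr. Qed.
Lemma k_scaleDl v : {morph k_scale^~ v : c c' / c + c'}.
Proof. by move=> c c'; rewrite /k_scale /scal scalerDl; apply: scalerDl. Qed.

HB.instance Definition _ := GRing.Zmodule_isLmodule.Build k (over_k M)
  k_scaleA k_scale1 k_scaleDr k_scaleDl.
End OverK.

Definition spanned M := exists (I : finType) (t : I -> M),
  forall v : M, exists c : I -> k, v = \sum_i scal (c i) *: t i.

(** The algebra is spanned over [k] by the [e_{x,y}], so a module is spanned by
the products of generators by these. *)
Lemma fg_spanned M : finitely_generated M -> spanned M.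
Proof.
case=> s gen_s.
exists ('I_(size s) * {xy : P * P | (xy.1 <= xy.2)%O})%type.
exists (fun iu : 'I_(size s) * {xy : P * P | (xy.1 <= xy.2)%O} =>
  (ia_e k (val iu.2).1 (val iu.2).2 : A^c) *: s`_iu.1) => v.
have [c ->] := gen_s v; exists (fun iu => (c iu.1 : A) iu.2).
rewrite -(pair_bigA _ (fun i u => scal ((c i : A) u) *:
  ((ia_e k (val u).1 (val u).2 : A^c) *: s`_i))) /=.
apply: eq_bigr => i _; rewrite [c i in LHS]ia_sum_e scaler_suml.
by apply: eq_bigr => u _; rewrite -scalE.
Qed.

Lemma spanned_fg M : spanned M -> finitely_generated M.
Proof.
case=> I [t span_t].
exists (codom t) => v; have [c ->] := span_t v.
have sz : size (codom t) = #|I| by rewrite size_codom.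
exists (fun j => scal (c (enum_val (cast_ord sz j)))).
rewrite (reindex (fun j : 'I_(size (codom t)) => enum_val (cast_ord sz j))) /=.
  apply: eq_bigr => j _; congr (_ *: _).
  set i := cast_ord sz j; have -> : val j = val i by [].
  by rewrite /codom /image_mem -codomE nth_codom.
exists (fun i => cast_ord (esym sz) (enum_rank i)) => i _.
  by rewrite enum_valK cast_ordK.
by rewrite cast_ordKV enum_rankK.
Qed.

End Alg.

(** * Corners *)

Section Corner.
Variables (k : fieldType) (d : Order.disp_t) (P : finPOrderType d).
Local Notation A := (incidence_algebra k P).

(** The identity [cidemM] says that compressing by the idempotent on both sides
is compatible with products; it holds for the idempotent of a convex set of
vertices, and it is what makes [a |-> v a g] an action on the vectors [v] with
[v g = v]. Submodules supported on an up-set and quotients supported on the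
complement are both of this form. *)
Record corner_idem : Type := CornerIdem {
  cidem :> A;
  cidemK : cidem * cidem = cidem;
  cidemM : forall a b : A,
    cidem * a * cidem * b * cidem = cidem * a * b * cidem }.

Variables (g : corner_idem) (M : lmodType A^c).

Definition corner_pred : {pred M} := [pred v | (cidem g : A^c) *: v == v].

Lemma corner_zmod_closed : zmod_closed corner_pred.
Proof.
split=> [|u v]; first by apply/eqP; rewrite scaler0.
move=> /eqP gu /eqP gv; apply/eqP.
by rewrite scalerBr gu gv.
Qed.

HB.instance Definition _ := GRing.isZmodClosed.Build M corner_pred corner_zmod_closed.

Record corner : Type := Corner { corner_val : M; cornerP : corner_val \in corner_pred }.

HB.instance Definition _ := [isSub of corner for corner_val].
HB.instance Definition _ := [Choice of corner by <:].
HB.instance Definition _ := [SubChoice_isSubZmodule of corner by <:].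

Lemma corner_proj_subproof (v : M) : (cidem g : A^c) *: v \in corner_pred.
Proof. by apply/eqP; rewrite actM cidemK. Qed.

Definition corner_proj (v : M) : corner := Corner (corner_proj_subproof v).

Lemma cornerE (v : corner) : (cidem g : A^c) *: val v = val v.
Proof. exact: eqP (cornerP v). Qed.

Definition corner_scale (a : A^c) (v : corner) : corner := corner_proj (a *: val v).

Lemma corner_scaleA a b v : corner_scale a (corner_scale b v) = corner_scale (a * b) v.
Proof.
apply/val_inj => /=; rewrite -[val v]cornerE -[a * b](erefl ((b : A) * a : A)) !actM.
by rewrite !mulrA cidemM.
Qed.

Lemma corner_scale1 : left_id 1 corner_scale.
Proof. by move=> v; apply/val_inj; rewrite /= scale1r cornerE. Qed.

Lemma corner_scaleDr : right_distributive corner_scale +%R.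
Proof. by move=> c u v; apply/val_inj; rewrite /= !scalerDr. Qed.

Lemma corner_scaleDl v : {morph corner_scale^~ v : a b / a + b}.
Proof. by move=> a b; apply/val_inj; rewrite /= scalerDl scalerDr. Qed.

HB.instance Definition _ := GRing.Zmodule_isLmodule.Build A^c corner
  corner_scaleA corner_scale1 corner_scaleDr corner_scaleDl.

Lemma spanned_corner : spanned M -> spanned corner.
Proof.
case=> I [t span_t]; exists I, (corner_proj \o t) => v.
have [c eq_v] := span_t (val v); exists c; apply/val_inj.
rewrite -[LHS]cornerE raddf_sum {1}eq_v scaler_sumr; apply: eq_bigr => i _ /=.
by rewrite -!scalC; congr (_ *: _); rewrite actM cidemK.
Qed.
End Corner.

Arguments corner_proj {k d P} g {M} v.

(** * Simple modules and extensions along covers *)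

Section Modules.
Variables (k : fieldType) (d : Order.disp_t) (P : finPOrderType d).
Local Notation A := (incidence_algebra k P).
Implicit Types (a b : A) (x y z : P) (S : {set P}) (c : k).

(** Corner at an up-set: the submodule supported on it. *)
Lemma up_set_cidem S : up_set S -> exists g : corner_idem k P, g = idem k S :> A.
Proof.
move=> upS; have gg : idem k S * idem k S = idem k S by rewrite idemI setIid.
have cv (a b : A) : idem k S * a * idem k S * b * idem k S = idem k S * a * b * idem k S.
  by rewrite up_set_idem.
by exists (CornerIdem gg cv).
Qed.

(** Corner at the complement of an up-set: the quotient supported off it. *)
Lemma up_setC_cidem S : up_set S -> exists g : corner_idem k P, g = idem k (~: S) :> A.
Proof.
move=> upS; have gg : idem k (~: S) * idem k (~: S) = idem k (~: S).
  by rewrite idemI setIid.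
have cv (a b : A) : idem k (~: S) * a * idem k (~: S) * b * idem k (~: S)
    = idem k (~: S) * a * b * idem k (~: S).
  by rewrite -!mulrA (mulrA (idem k (~: S)) b) up_set_idemC.
by exists (CornerIdem gg cv).
Qed.

Lemma coef1 x : ia_coef (1 : A) x x = 1.
Proof. by rewrite ia_coef_one eqxx. Qed.

(** By antisymmetry, [x] is the only vertex between [x] and [x]. *)
Lemma coefM_diag a b x : ia_coef (a * b) x x = ia_coef a x x * ia_coef b x x.
Proof.
rewrite ia_coefM (bigD1 x) //= big1 ?addr0 // => y ne_yx.
have [le_xy | /ia_coef_out->] := boolP (x <= y)%O; last by rewrite mul0r.
rewrite [ia_coef b _ _]ia_coef_out ?mulr0 //; apply: contra ne_yx => le_yx.
by rewrite eq_le le_xy le_yx.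
Qed.

(** The one-dimensional module at the vertex [x]. *)
Definition simple (x : P) : Type := k.
HB.instance Definition _ x := GRing.Zmodule.on (simple x).

Section Simple.
Variable x : P.
Definition simple_scale (a : A^c) (u : simple x) : simple x := ia_coef (a : A) x x * u.

Lemma simple_scaleA (a b : A^c) u :
  simple_scale a (simple_scale b u) = simple_scale (a * b) u.
Proof. by rewrite /simple_scale [_ (a * b) x x]coefM_diag mulrA [X in X * u]mulrC. Qed.
Lemma simple_scale1 : left_id 1 simple_scale.
Proof. by move=> u; rewrite /simple_scale coef1 mul1r. Qed.
Lemma simple_scaleDr : right_distributive simple_scale +%R.
Proof. by move=> a u v; apply: mulrDr. Qed.
Lemma simple_scaleDl u : {morph simple_scale^~ u : a b / a + b}.
Proof. by move=> a b; rewrite /simple_scale ia_coefD mulrDl. Qed.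
HB.instance Definition _ := GRing.Zmodule_isLmodule.Build A^c (simple x)
  simple_scaleA simple_scale1 simple_scaleDr simple_scaleDl.

Lemma simple_scaleE a (u : simple x) : (a : A^c) *: u = ia_coef a x x * u :> k.
Proof. by []. Qed.

Lemma coef_scal c y : ia_coef (scal P c : A) y y = c.
Proof. by rewrite /scal ia_coefZ coef1 mulr1. Qed.

Lemma simple_fg : finitely_generated (simple x : lmodType A^c).
Proof.
apply: spanned_fg; exists unit, (fun=> 1 : simple x) => v; exists (fun=> v).
by rewrite big_const cardT enumT unlock /= addr0 simple_scaleE coef_scal mulr1.
Qed.

Definition simple_mod : fgmod A := FGMod simple_fg.
End Simple.

Section Cover.
Variables (x y : P) (lt_yx : (y < x)%O) (cov : forall z, ~~ (y < z < x)%O).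

(** The diagonal coefficients at [y] and [x] together with the coefficient at
[(y, x)] form a triangular matrix, multiplicatively in the element, because no
other vertex contributes to the product. *)
Lemma coefM_cover a b :
  ia_coef (a * b) y x = ia_coef a y y * ia_coef b y x + ia_coef a y x * ia_coef b x x.
Proof.
have ne_xy : x != y by rewrite gt_eqF.
rewrite ia_coefM (bigD1 y) //= (bigD1 x) //= big1 ?addr0 // => z /andP[ne_zy ne_zx].
have [le_yz | /ia_coef_out->] := boolP (y <= z)%O; last by rewrite mul0r.
have [le_zx | /ia_coef_out->] := boolP (z <= x)%O; last by rewrite mulr0.
by have := cov z; rewrite !lt_neqAle le_yz le_zx ne_zx eq_sym ne_zy.
Qed.

(** The plane with the first coordinate at [x], the second at [y], and [e_{y,x}]
mapping the second to the first. The proofs are parameters of the type because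
the module structure depends on them. *)
Definition cover_ext (y x : P) (_ : (y < x)%O) (_ : forall z, ~~ (y < z < x)%O) : Type :=
  (k * k)%type.
Local Notation E := (cover_ext lt_yx cov).
HB.instance Definition _ := GRing.Zmodule.on E.

Definition cover_scale (a : A^c) (u : E) : E :=
  (ia_coef (a : A) x x * u.1 + ia_coef (a : A) y x * u.2, ia_coef (a : A) y y * u.2).

Lemma cover_scaleA (a b : A^c) u :
  cover_scale a (cover_scale b u) = cover_scale (a * b) u.
Proof.
have eqM x' : ia_coef (a * b : A^c) x' x' = ia_coef (b : A) x' x' * ia_coef (a : A) x' x'.
  exact: coefM_diag.
congr (_, _); rewrite /= !eqM; last by ring.
by rewrite [ia_coef (a * b) y x]coefM_cover; ring.
Qed.
Lemma cover_scale1 : left_id 1 cover_scale.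
Proof.
move=> [u v]; congr (_, _); rewrite /= coef1 !mul1r // ia_coef_one lt_eqF //.
by rewrite mul0r addr0.
Qed.
Lemma cover_scaleDr : right_distributive cover_scale +%R.
Proof. by move=> a u v; congr (_, _); rewrite /= !mulrDr //; ring. Qed.
Lemma cover_scaleDl u : {morph cover_scale^~ u : a b / a + b}.
Proof. by move=> a b; congr (_, _); rewrite /= !ia_coefD; ring. Qed.
HB.instance Definition _ := GRing.Zmodule_isLmodule.Build A^c E
  cover_scaleA cover_scale1 cover_scaleDr cover_scaleDl.

Lemma cover_scaleE (a : A^c) (u : E) : a *: u =
  (ia_coef (a : A) x x * u.1 + ia_coef (a : A) y x * u.2, ia_coef (a : A) y y * u.2).
Proof. by []. Qed.

Lemma cover_fg : finitely_generated (E : lmodType A^c).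
Proof.
apply: spanned_fg; exists bool, (fun i : bool => if i then (1, 0) else (0, 1) : E) => v.
exists (fun i : bool => if i then v.1 else v.2).
have scal_yx c : ia_coef (scal P c : A) y x = 0.
  by rewrite /scal ia_coefZ ia_coef_one lt_eqF ?mulr0.
rewrite big_bool !cover_scaleE /= !coef_scal !scal_yx.
by case: v => v w; congr (_, _); rewrite /= !(mulr0, mul0r, mulr1, addr0, add0r).
Qed.
Definition cover_mod : fgmod A := FGMod cover_fg.

Definition cover_in (u : simple_mod x) : cover_mod := (u, 0).
Definition cover_out (u : cover_mod) : simple_mod y := u.2.
Lemma cover_in_linear : linear cover_in.
Proof.
move=> a u v; apply: injective_projections => /=; last by rewrite !mulr0 addr0.
by rewrite mulr0 addr0.
Qed.
Lemma cover_out_linear : linear cover_out.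
Proof. by []. Qed.
HB.instance Definition _ :=
  GRing.isLinear.Build A^c (simple_mod x) cover_mod *:%R cover_in cover_in_linear.
HB.instance Definition _ :=
  GRing.isLinear.Build A^c cover_mod (simple_mod y) *:%R cover_out cover_out_linear.

Lemma cover_exact : short_exact cover_in cover_out.
Proof.
split=> [u v [] // | v | [u v]]; first by exists (0, v).
by split=> [/= -> | [u' [_ <-]] //]; exists u.
Qed.

(** [e_{y,x}] acts as zero on the direct sum of the two simple modules, but not
on the plane. *)
Lemma cover_Ext1_neq0 : ~ Ext1_zero (simple_mod y) (simple_mod x).
Proof.
case/(_ (Extension cover_exact)) => f [f_in f_out].
pose e : A^c := ia_e k y x; have le_yx := ltW lt_yx.
pose u : cover_mod := (0, 1).
have eu : e *: u = cover_in 1.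
  rewrite cover_scaleE !ia_coef_e // !eqxx /= (gt_eqF lt_yx) (lt_eqF lt_yx) /=.
  by congr (_, _); rewrite ?mulr1 ?mul0r ?add0r.
(* [f_in 1] computes [f (e *: u)] as the vector 1 at [x]; by linearity it is also
   [e *: f u], whose component at [x] is zero. *)
have /(congr1 fst) := f_in 1; rewrite -[ext_inj _ _]eu linearZ /=.
rewrite [X in X = _]simple_scaleE ia_coef_e // (gt_eqF lt_yx) /= mul0r.
by move/eqP; rewrite eq_sym oner_eq0.
Qed.

End Cover.
End Modules.

(** * Torsion pairs *)

Lemma linear_exists (R : pzRingType) (U V : lmodType R) (f : U -> V) :
  linear f -> exists g : {linear U -> V}, g =1 f.
Proof.
move=> lin_f; pose mix := GRing.isLinear.Build R U V *:%R f lin_f.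
by exists (HB.pack f mix : {linear U -> V}).
Qed.

Section TorsionPairLemmas.
Variable A : pzRingType.

Lemma inj_surj_bij (U V : lmodType A^c) (f : {linear U -> V}) :
  injective f -> (forall v, exists u, f u = v) -> bijective f.
Proof.
move=> inj_f surj_f; have surj_fb v : exists u, f u == v.
  by have [u <-] := surj_f v; exists u.
have fK v : f (xchoose (surj_fb v)) = v := eqP (xchooseP (surj_fb v)).
by exists (fun v => xchoose (surj_fb v)) => v; last exact: fK; apply/inj_f/fK.
Qed.

Variables (T F : subcategory A) (TF : torsion_pair T F).

(** The projection of [X] to its torsion-free part vanishes, so [X] is its own
torsion part. *)
Lemma tors_ortho X : (forall Y, F Y -> Hom_zero X Y) -> T X.
Proof.
move=> homX; have [tX [fX [i [p [TtX FfX [inj_i _ ex]]]]]] := TF.2 X.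
apply: subcat_iso TtX; exists i; apply: inj_surj_bij => // v.
by apply/ex; apply: homX.
Qed.

(** The inclusion of the torsion part vanishes, so [X] is its own torsion-free
quotient. *)
Lemma tfree_ortho X : (forall Y, T Y -> Hom_zero Y X) -> F X.
Proof.
move=> homX; have [tX [fX [i [p [TtX FfX [inj_i surj_p ex]]]]]] := TF.2 X.
have inj_p : injective p.
  move=> u v eq_uv; apply/eqP; rewrite -subr_eq0.
  have /ex[w <-] : p (u - v) = 0 by rewrite linearB eq_uv subrr.
  by rewrite homX.
have [q pK qK] := inj_surj_bij inj_p surj_p.
have lin_q : linear q.
  by move=> a u v; apply: inj_p; rewrite linearP !qK.
have [h h_q] := linear_exists lin_q.
apply: subcat_iso FfX; exists h; exists p => v; rewrite h_q; [exact: qK | exact: pK].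
Qed.

End TorsionPairLemmas.

(** * The torsion pair of an up-set *)

Section Classification.
Variables (k : fieldType) (d : Order.disp_t) (P : finPOrderType d).
Local Notation A := (incidence_algebra k P).
Implicit Types (x y z : P) (S : {set P}) (c : k) (M N X Y : fgmod A).
Local Notation e_ S := (idem k S : A^c).

(** [M] is supported off [S]; the modules supported on [S] are those with
[vanishes (~: S) M]. *)
Definition vanishes S M : Prop := forall v : M, e_ S *: v = 0.

Lemma vanishes_iso S M N : isomorphic M N -> vanishes S M -> vanishes S N.
Proof. by case=> f [g _ fK] vM v; rewrite -[v]fK -linearZ vM linear0. Qed.

Definition vanishing S : subcategory A := Subcategory (@vanishes_iso S).

Lemma vanishes_sub S S' M : S' \subset S -> vanishes S M -> vanishes S' M.
Proof.
move=> sS'S vM v; rewrite -[idem k S'](_ : idem k S * idem k S' = _).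
  by rewrite -actM vM scaler0.
by rewrite idemI; congr (idem _ _); apply/setIidPr.
Qed.

Lemma idem_split S M (v : M) : v = e_ S *: v + e_ (~: S) *: v.
Proof.
rewrite -scalerDl -[X in X *: _](erefl (idem k S + idem k (~: S))).
by rewrite idemC scale1r.
Qed.

Lemma vanishesC S M : vanishes (~: S) M -> forall v : M, e_ S *: v = v.
Proof. by move=> vM v; rewrite [RHS](idem_split S) vM addr0. Qed.

Lemma vanishes_Hom_zero S M N : vanishes (~: S) M -> vanishes S N -> Hom_zero M N.
Proof.
by move=> vM vN f v; rewrite -(vanishesC vM v) linearZ; apply: vN.
Qed.

Section UpSet.
Variables (S : {set P}) (upS : up_set S).

(** The two corners of [X], at [S] and at its complement, are the torsion part
and the torsion-free part. *)
Lemma vanishing_torsion_pair : torsion_pair (vanishing (~: S)) (vanishing S).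
Proof.
split=> [X Y TX FY | X]; first exact: vanishes_Hom_zero TX FY.
have [g eq_g] := up_set_cidem k upS; have [h eq_h] := up_setC_cidem k upS.
have fgX := fg_spanned (fgmodP X).
pose tX := FGMod (spanned_fg (spanned_corner g fgX)).
pose fX := FGMod (spanned_fg (spanned_corner h fgX)).
have lin_i : linear (fun v : corner g X => val v : X).
  move=> a u v; rewrite raddfD /= -[val u]cornerE eq_g.
  by rewrite !actM mulrA up_set_idem.
have lin_p : linear (corner_proj h : X -> corner h X).
  move=> a u v; apply/val_inj; rewrite raddfD /= scalerDr eq_h.
  by rewrite !actM mulrA up_set_idemC.
have [i iE] := linear_exists lin_i; have [p pE] := linear_exists lin_p.
exists tX, fX, i, p; split.
- move=> v; apply/val_inj; rewrite /= -[val v]cornerE eq_g.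
  by rewrite !actM !idemI [~: S :&: S]setIC setICr setI0 idem0 scale0r.
- move=> v; apply/val_inj; rewrite /= -[val v]cornerE eq_h.
  by rewrite !actM !idemI setICr setI0 idem0 scale0r.
split=> [u v | z | v].
- by rewrite !iE => /val_inj.
- by exists (val z); rewrite pE; apply/val_inj; rewrite /= cornerE.
rewrite pE; split=> [/(congr1 val) | [u <-]].
  rewrite /= eq_h => hv0; exists (corner_proj g v).
  by rewrite iE /= eq_g [RHS](idem_split S) hv0 addr0.
apply/val_inj; rewrite /= eq_h iE -[val u]cornerE eq_g actM idemI setICr.
by rewrite idem0 scale0r.
Qed.

(** In an extension [E] of [X] by [Y], the component of a vector off [S] maps to
zero in [X], so it comes from [Y]; this gives a retraction of [E] onto [Y],
which is a morphism because the complement of [S] is a down-set. *)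
Lemma vanishing_Ext1 X Y : vanishing (~: S) X -> vanishing S Y -> Ext1_zero X Y.
Proof.
move=> /= TX FY [E i p [inj_i surj_p ex]].
have ex_r (v : E) : exists y : Y, i y == e_ (~: S) *: v.
  have /ex[y <-] : p (e_ (~: S) *: v) = 0 by rewrite linearZ; apply: TX.
  by exists y.
pose r v := xchoose (ex_r v).
have rP v : i (r v) = e_ (~: S) *: v := eqP (xchooseP (ex_r v)).
have FY' (y : Y) : e_ (~: S) *: y = y by rewrite [RHS](idem_split S) FY add0r.
have lin_f : linear (fun v => (r v, p v) : split_extension X Y).
  move=> a u v; apply: injective_projections; rewrite /= ?linearP //.
  apply: inj_i; rewrite linearP !rP scalerDr; congr (_ + _).
  transitivity (e_ (~: S) *: (a *: i (r u))).
    by rewrite rP !actM mulrA up_set_idemC.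
  rewrite -rP; transitivity (i (e_ (~: S) *: (a *: r u))); first by rewrite !linearZ.
  by rewrite FY' linearZ.
have [f fE] := linear_exists lin_f.
exists f; split=> [y | v]; rewrite fE //=.
rewrite /dsum_in /=; congr (_, _); last by apply/ex; exists y.
by apply: inj_i; rewrite rP -[in RHS](FY' y) linearZ.
Qed.

Definition up_set_otp : omega_torsion_pair A :=
  OmegaTorsionPair vanishing_torsion_pair vanishing_Ext1.

End UpSet.

Lemma vanishes_simple S x : vanishes S (simple_mod k x) <-> x \notin S.
Proof.
split=> [v0 | nSx v].
  apply/negP => Sx; have /eqP := v0 1.
  by rewrite simple_scaleE coef_idem Sx eqxx mulr1 oner_eq0.
by rewrite simple_scaleE coef_idem (negPf nSx) mul0r.
Qed.

Lemma up_set_otp_le S S' (upS : up_set S) (upS' : up_set S') :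
  otp_le (up_set_otp upS) (up_set_otp upS') <-> S \subset S'.
Proof.
split=> [le_SS' | sSS' X]; last by apply: vanishes_sub; rewrite setCS.
  apply/subsetP => x Sx; have := le_SS' (simple_mod k x).
  rewrite /= !vanishes_simple !inE !negbK; exact.
Qed.

(** * Every [omega]-torsion pair comes from an up-set *)

(** A vector on which the algebra acts through the scalars [a_{x,x}] spans a
quotient of the simple module at [x]. *)
Lemma simple_hom x Y (w : Y) :
    (forall a : A, (a : A^c) *: w = scal P (ia_coef a x x) *: w) ->
  exists h : {linear simple_mod k x -> Y}, h 1 = w.
Proof.
move=> wE; have lin_h : linear (fun c : simple_mod k x => scal P c *: w : Y).
  move=> a b c; rewrite simple_scaleE -[a *: _]scalC (wE a).
  rewrite [LHS](k_scaleDl (w : over_k Y)).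
  by rewrite [X in _ = X + _](k_scaleA _ _ (w : over_k Y)) mulrC.
have [h hE] := linear_exists lin_h; exists h; rewrite hE.
exact: (k_scale1 (w : over_k Y)).
Qed.

(** Strict inequalities are generated by covers, by induction on the number of
elements strictly in between. *)
Lemma cover_ind (Q : P -> P -> Prop) :
    (forall x y, (x < y)%O -> (forall z, ~~ (x < z < y)%O) -> Q x y) ->
    (forall x z y, (x < z)%O -> (z < y)%O -> Q x z -> Q z y -> Q x y) ->
  forall x y, (x < y)%O -> Q x y.
Proof.
move=> Qcov Qtr x y; have [n] := ubnP #|[set z | (x < z < y)%O]|.
elim: n x y => // n IHn x y /ltnSE le_n lt_xy.
have [/existsP[z /andP[lt_xz lt_zy]] | ] := boolP [exists z, (x < z < y)%O].
  have lt_card (s t : P) : ((s == x) && (t == z)) || ((s == z) && (t == y)) ->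
      (#|[set u | (s < u < t)%O]| < n)%N.
    move=> st; apply: leq_trans le_n; apply: proper_card; apply/properP; split.
      apply/subsetP => u; rewrite !inE; case/orP: st => /andP[/eqP-> /eqP->].
        by case/andP=> -> /lt_trans->.
      by case/andP=> /(lt_trans lt_xz)-> ->.
    exists z; rewrite !inE ?lt_xz //.
    by case/orP: st => /andP[/eqP-> /eqP->]; rewrite ltxx ?andbF.
  apply: (Qtr x z y) => //; apply: IHn => //; apply: lt_card; rewrite !eqxx ?orbT //.
by rewrite negb_exists => /forallP; apply: Qcov.
Qed.

Lemma sum_idem_zero M N (f : {linear M -> N}) S :
  (forall x, x \in S -> forall v, f (e_ [set x] *: v) = 0) ->
  forall v, f (e_ S *: v) = 0.
Proof.
move=> f0 v; rewrite [X in X *: _](idem_sum k S) scaler_suml linear_sum big1 //.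
by move=> x Sx; apply: f0.
Qed.

Lemma Hom_zero_idem M N (f : {linear M -> N}) :
  (forall x v, f (e_ [set x] *: v) = 0) -> forall v, f v = 0.
Proof.
move=> f0 v; have := sum_idem_zero (S := setT) (fun x _ => f0 x) v.
by rewrite [X in X *: _]idemT scale1r.
Qed.

(** Induction on the number of [r]-predecessors; used for the order of [P] and
for its opposite. *)
Lemma finite_strict_ind (r : rel P) (Q : P -> Prop) : irreflexive r -> transitive r ->
  (forall x, (forall y, r y x -> Q y) -> Q x) -> forall x, Q x.
Proof.
move=> irr tr IH x; have [n] := ubnP #|[set y | r y x]|.
elim: n x => // n IHn x /ltnSE le_n; apply: IH => y r_yx; apply: IHn.
apply: leq_trans le_n; apply: proper_card; apply/properP; split.
  by apply/subsetP => z; rewrite !inE => /tr; apply.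
by exists y; rewrite !inE ?irr.
Qed.

Section Surjective.
Variable p : omega_torsion_pair A.
Let TF := otp_torsion_pair p.

(** The torsion part of a simple module is zero or the whole of it, because the
module has dimension 1. *)
Lemma simple_tors_or_tfree x : tors p (simple_mod k x) \/ tfree p (simple_mod k x).
Proof.
have [tX [fX [i [q [TtX FfX [inj_i surj_q ex]]]]]] := TF.2 (simple_mod k x).
have [[v nz_v] | i0] := EM (exists v, i v != 0).
  left; apply: subcat_iso TtX; exists i; apply: inj_surj_bij => // u.
  exists (scal P ((u : k) / (i v : k)) *: v).
  by rewrite linearZ; apply: etrans (simple_scaleE _ _) _; rewrite coef_scal divfK.
right; apply: (tfree_ortho TF) => Y TY f w; apply/eqP/contraT => nz_fw.
have inj_q : injective q.
  move=> u v eq_uv; apply/eqP; rewrite -subr_eq0.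
  have /ex[t <-] : q (u - v) = 0 by rewrite linearB eq_uv subrr.
  by apply/contraT => nz; case: i0; exists t.
have qf : q (f w) = 0 by apply: (TF.1 Y fX TY FfX (q \o f)).
by move/eqP: nz_fw; case; apply: inj_q; rewrite qf linear0.
Qed.

(** For a cover [x < y], a torsion module at [x] and a torsion-free one at [y]
would have only split extensions. *)
Lemma simple_tors_up x y : (x <= y)%O ->
  tors p (simple_mod k x) -> tors p (simple_mod k y).
Proof.
rewrite le_eqVlt => /predU1P[-> // |]; move: x y; apply: cover_ind => [x y lt_xy cov | ].
  move=> Tx; have [// | Fy] := simple_tors_or_tfree y.
  by case: (cover_Ext1_neq0 (k := k) lt_xy cov); apply: (otp_Ext1 Tx Fy).
by move=> x z y _ _ xz zy /xz/zy.
Qed.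

Variable S : {set P}.
Hypothesis SP : forall x, (x \in S) <-> tors p (simple_mod k x).

(** Let [f : X -> Y] with [Y] torsion-free. If [f] vanishes at all vertices above
[x \in S], then the algebra acts on the image of the space at [x] by scalars, so
each vector of this image is a value of a morphism from a simple torsion module. *)
Lemma supported_tors X : vanishes (~: S) X -> tors p X.
Proof.
move=> vX; apply: (tors_ortho TF) => Y FY f; apply: Hom_zero_idem.
apply: (@finite_strict_ind (fun y x => (x < y)%O)) => [x | y x z /= | x IHx v].
- exact: ltxx.
- by move=> lt_xy lt_yz; apply: lt_trans lt_yz lt_xy.
have [Sx | nSx] := boolP (x \in S); last first.
  by rewrite (vanishes_sub _ vX) ?linear0 // sub1set inE.
set w := f _.
have wE a : (a : A^c) *: w = scal P (ia_coef a x x) *: w.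
  rewrite -linearZ actM idem1M scalerDl linearD [X in _ + X](_ : _ = 0) ?addr0.
    by rewrite scalE linearZZ.
  by rewrite -actM; apply: sum_idem_zero => y; rewrite inE; apply: IHx.
have [h <-] := simple_hom wE.
exact: TF.1 _ _ ((SP x).1 Sx) FY h 1.
Qed.

(** Let [f : Y -> X] with [Y] torsion. If [f] vanishes at all vertices below
[x \notin S], then composing its component at [x] with a linear functional
gives a morphism from [Y] to a simple torsion-free module. The functional is
chosen nonzero at a given nonzero value of [f]. *)
Lemma vanishing_tfree X : vanishes S X -> tfree p X.
Proof.
move=> vX; apply: (tfree_ortho TF) => Y TY f; apply: Hom_zero_idem.
apply: (@finite_strict_ind (fun y x => (y < x)%O)) => [x | y x z /= | x IHx v].
- exact: ltxx.
- exact: lt_trans.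
have [Sx | nSx] := boolP (x \in S).
  by rewrite linearZ; apply: (vanishes_sub _ vX); rewrite sub1set.
apply/eqP/contraT => nz_w.
have [I [t span_t]] := fg_spanned (fgmodP X).
have [l lin_l nz_l] := exists_functional (V := over_k X) span_t nz_w.
have f0 u : f (e_ [set y | (y < x)%O] *: u) = 0.
  by apply: sum_idem_zero => y; rewrite inE; apply: IHx.
have lin_h : linear (fun y : Y => l (f (e_ [set x] *: y)) : simple_mod k x).
  move=> a y z; rewrite scalerDr actM Midem1 scalerDl !linearD.
  rewrite [X in _ + X + _](_ : _ = 0) ?addr0; last first.
    by rewrite -!actM 2!linearZZ f0 !scaler0.
  by rewrite scalE linearZZ; apply: lin_l.
have [h hE] := linear_exists lin_h.
have Fx : tfree p (simple_mod k x).
  by have [/SP Sx|//] := simple_tors_or_tfree x; rewrite Sx in nSx.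
have := TF.1 _ _ TY Fx h v; rewrite hE => l0.
by rewrite l0 eqxx in nz_l.
Qed.

End Surjective.
End Classification.

(** * Dyck paths as order ideals of intervals *)

Section Ideals.
Variable n : nat.
Implicit Types (D E : dyck n) (I J : Int n.-1).

(** With indices starting from 0, the interval [[i, j]] is drawn at the point
[(i + j + 2, j - i + 2)]; these are the points of height at least 2 that some
Dyck path goes through. *)
Definition under D I : bool :=
  ((Int_ends I).2 - (Int_ends I).1).+2%:Z
    <= height D ((Int_ends I).1 + (Int_ends I).2).+2.

Lemma Int_bounds I : ((Int_ends I).1 <= (Int_ends I).2)%N /\ ((Int_ends I).2.+1 < n)%N.
Proof. by have := IntP I; have := ltn_ord (Int_ends I).2; lia. Qed.

Lemma Int_of (i j : nat) : (i <= j)%N -> (j.+1 < n)%N ->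
  exists I, (Int_ends I).1 = i :> nat /\ (Int_ends I).2 = j :> nat.
Proof.
move=> le_ij lt_jn; have lt_j : (j < n.-1)%N by lia.
have lt_i : (i < n.-1)%N by lia.
by exists (@MkInt n.-1 (Ordinal lt_i, Ordinal lt_j) le_ij).
Qed.

Lemma height_lipschitz D s t : (s <= n.*2)%N -> (t <= n.*2)%N ->
  height D t <= height D s + `|t%:Z - s%:Z|.
Proof.
have up i e : (i + e <= n.*2)%N -> `|height D (i + e) - height D i| <= e%:Z.
  elim: e => [|e IHe] le_ie; first by rewrite addn0; lia.
  rewrite addnS dyck_heightS -?addnS //.
  have := IHe (ltnW (leq_trans _ le_ie)); rewrite addnS ltnSn => /(_ isT).
  by case: nth; lia.
move=> le_s le_t; have [le_st | lt_ts] := leqP s t.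
  by have := up s (t - s)%N; rewrite subnKC // => /(_ le_t); lia.
by have := up t (s - t)%N; rewrite (subnKC (ltnW lt_ts)) => /(_ le_s); lia.
Qed.

Lemma height_mod2 D t : (t <= n.*2)%N -> exists z : int, height D t = t%:Z + z *+ 2.
Proof.
elim: t => [|t IHt] lt_t; first by exists 0; rewrite height0.
have [z eq_z] := IHt (ltnW lt_t); rewrite dyck_heightS // eq_z.
by case: nth; [exists z | exists (z - 1)]; lia.
Qed.

(** Shrinking the interval moves the point sideways by at most as much as it
moves it down, and paths have slope 1. *)
Lemma under_Int_le D I J : Int_le J I -> under D I -> under D J.
Proof.
rewrite Int_leE /under => le_JI.
have [le_I lt_I] := Int_bounds I; have [le_J lt_J] := Int_bounds J.
have := @height_lipschitz D ((Int_ends J).1 + (Int_ends J).2).+2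
  ((Int_ends I).1 + (Int_ends I).2).+2.
move: (height D _) (height D _) => hI hJ; lia.
Qed.

(** A point of [D] at height at least 2 is the point of an interval. At lower
heights the parity of the abscissa determines the height, so [E] cannot be
strictly below [D] there. *)
Lemma dyck_le_under D E : (D <= E)%O <-> forall I, under D I -> under E I.
Proof.
split=> [/dyck_leP le_DE I | sub_DE].
  have [le_I lt_I] := Int_bounds I.
  by move/le_trans; apply; apply: le_DE; lia.
apply/dyck_leP => t le_t.
have D_ge0 := dyck_height_ge0 D le_t; have E_ge0 := dyck_height_ge0 E le_t.
have [z eqD] := height_mod2 D le_t; have [z' eqE] := height_mod2 E le_t.
have le_hD := @height_lipschitz D 0 t (leq0n _) le_t; rewrite height0 in le_hD.
have le_hD' := @height_lipschitz D n.*2 t (leqnn _) le_t.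
rewrite dyck_height_end in le_hD'.
have [ge2 | lt2] := leP 2 (height D t); last by lia.
(* With [height D t = t + 2 z], solving [i + j + 2 = t] and [j - i + 2 = t + 2 z]
   gives [i = - z] and [j = t + z - 2]. *)
have [|| I [I1 I2]] := @Int_of (absz (- z)%R) (absz (t%:Z + z - 2)%R); try lia.
have eq_t : ((Int_ends I).1 + (Int_ends I).2).+2 = t by lia.
by have := sub_DE I; rewrite /under eq_t; lia.
Qed.

(** The lowest path through the point [(a, h)]: the zigzag of heights 0 and 1, and
over it the mountain of slope 1 with top [(a, h)]. *)
Definition peak_height (a h : int) (t : nat) : int :=
  Num.max (odd t)%:Z (h - `|t%:Z - a|).

Lemma peak_dyck (a h : int) :
    (exists z : int, h = a + z *+ 2) -> h <= a -> h <= n.*2%:Z - a ->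
  exists D, forall t, (t <= n.*2)%N -> height D t = peak_height a h t.
Proof.
move=> [z eq_h] le_ha le_hna.
have hE t : (t <= n.*2)%N -> height (steps_of n (peak_height a h)) t = peak_height a h t.
  apply: height_steps_of => [|{}t lt_t]; rewrite /peak_height /=; lia.
have dyck_h : is_dyck (steps_of n (peak_height a h)).
  apply/andP; split; last by rewrite hE // /peak_height odd_double; lia.
  by apply/forallP => t; rewrite hE ?leq_ord // /peak_height; lia.
by exists (Dyck dyck_h).
Qed.

(** Heights of a join are maxima, so an interval is under a join when it is under
one of the paths; the intervals under the path with peak at [J] are those
contained in [J]. *)
Lemma dyck_under_ideal (s : seq (Int n.-1)) :
  exists D, forall I, under D I = has (Int_le I) s.
Proof.
elim: s => [|J s [D DE]].
  (* A peak at the origin adds nothing to the zigzag path. *)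
  have [|||D DE] := @peak_dyck 0 0; [by exists 0 | lia | lia | ].
  exists D => I; have [le_I lt_I] := Int_bounds I.
  by rewrite /under DE /peak_height /=; lia.
have [le_J lt_J] := Int_bounds J.
have [|||E EE] := @peak_dyck ((Int_ends J).1 + (Int_ends J).2).+2%:Z
  ((Int_ends J).2 - (Int_ends J).1).+2%:Z; try lia.
  by exists (- (Int_ends J).1%:Z); lia.
exists (dyck_join E D) => I /=; have [le_I lt_I] := Int_bounds I.
rewrite -DE /under height_join; last lia.
rewrite /join_height le_max; congr (_ || _).
by rewrite EE /peak_height ?Int_leE; lia.
Qed.

End Ideals.

(** * The isomorphism *)

Section OrderIso.
Variables (k : fieldType) (d : Order.disp_t) (P : finPOrderType d).
Local Notation A := (incidence_algebra k P).

Lemma subcategory_eq (T T' : subcategory A) : (forall X, T X <-> T' X) -> T = T'.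
Proof.
case: T T' => [T isoT] [T' isoT'] /= eqT.
have {}eqT : T = T' by apply/funext => X; apply/propext.
by case: _ / eqT isoT' => isoT'; congr Subcategory; apply: Prop_irrelevance.
Qed.

Lemma otp_eq (p q : omega_torsion_pair A) :
  (forall X, tors p X <-> tors q X) -> (forall X, tfree p X <-> tfree q X) -> p = q.
Proof.
case: p q => [T F tp ext] [T' F' tp' ext'] /= /subcategory_eq eqT /subcategory_eq eqF.
case: _ / eqT tp' ext' => tp' ext'; case: _ / eqF tp' ext' => tp' ext'.
by congr OmegaTorsionPair; apply: Prop_irrelevance.
Qed.

(** Both classes of the torsion pair of [S] are contained in those of [p], and a
class of a torsion pair is determined by the other one through orthogonality,
in a way that reverses inclusions. *)
Lemma up_set_otp_surj (p : omega_torsion_pair A) :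
  exists (S : {set P}) (upS : up_set S), p = up_set_otp k upS.
Proof.
pose S := [set x | `[< tors p (simple_mod k x) >]].
have SP x : (x \in S) <-> tors p (simple_mod k x).
  by rewrite inE; split=> /asboolP.
have upS : up_set S.
  by move=> x y le_xy /SP Sx; apply/SP/(simple_tors_up le_xy).
exists S, upS; apply: otp_eq => X; split.
- move=> TX; apply: (tors_ortho (vanishing_torsion_pair k upS)) => Y FY.
  by apply: (otp_torsion_pair p).1 TX _; apply: (vanishing_tfree SP).
- by move=> TX; apply: (supported_tors SP TX).
- move=> FX; apply: (tfree_ortho (vanishing_torsion_pair k upS)) => Y TY.
  by apply: (otp_torsion_pair p).1 _ FX; apply: (supported_tors SP).
- by move=> FX; apply: (vanishing_tfree SP FX).
Qed.

End OrderIso.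

Theorem theorem1p2 (k : fieldType) (n : nat) (hn : (1 <= n)%N) :
  exists phi : dyck n ->
      omega_torsion_pair (incidence_algebra k (Order.dual (Int n.-1))),
    bijective phi
    /\ (forall D D' : dyck n, (D <= D')%O <-> otp_le (phi D) (phi D')).
Proof.
pose S (D : dyck n) : {set Order.dual (Int n.-1)} := [set I | under D I].
have upS D : up_set (S D).
  by move=> I J le_IJ; rewrite !inE; apply: under_Int_le.
have leE D D' : (D <= D')%O <-> otp_le (up_set_otp k (upS D)) (up_set_otp k (upS D')).
  rewrite up_set_otp_le dyck_le_under.
  split=> [le_DD' | /subsetP le_DD' I]; last by have := le_DD' I; rewrite !inE.
  by apply/subsetP => I; rewrite !inE; apply: le_DD'.
exists (fun D => up_set_otp k (upS D)); split=> //.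
have surj p : exists D, up_set_otp k (upS D) = p.
  have [S' [upS' ->]] := up_set_otp_surj p.
  have [D DE] := dyck_under_ideal (enum S'); exists D.
  have eqS : S D = S'.
    apply/setP => I; rewrite inE DE; apply/hasP/idP => [[J] | S'I].
      by rewrite mem_enum => S'J le_IJ; apply: upS' S'J.
    by exists I; rewrite ?mem_enum //; apply: Int_le_refl.
  by case: _ / eqS upS' => upS'; congr up_set_otp; apply: Prop_irrelevance.
pose psi p := projT1 (cid (surj p)).
have psiK p : up_set_otp k (upS (psi p)) = p := projT2 (cid (surj p)).
exists psi => // D; apply: le_anti; apply/andP.
by split; apply/leE; rewrite psiK.
Qed.
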